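(* Let $n\ge 4$ be even. The maximally entangled state $$\Phi_J=\begin{pmatrix}\cos(\pi/n)&\sin(\pi/n)&0\\-\sin(\pi/n)&\cos(\pi/n)&0\\0&0&1\end{pmatrix}$$ of the bipartite regular $n$-gon system exhibits Hardy's nonlocality, with success probability $\sin^2(\pi/n)$. That is, the maximum of $P(E_1^{A+},E_1^{B+})$ over all choices of measurements (of the type described in the context) for which the probabilities computed on $\Phi_J$ satisfy $P(E_1^{A+},E_2^{B+})=0$, $P(E_2^{A+},E_1^{B+})=0$ and $P(E_2^{A-},E_2^{B-})=0$ equals $\sin^2(\pi/n)>0$.
   Context: Polygon model, $n$ even. Let $r_n=\sqrt{\sec(\pi/n)}$. The elementary state space $\Omega_n$ is the convex hull in $\mathbb R^3$ of the pure states $\omega_i=(r_n\cos\frac{2\pi i}{n},\,r_n\sin\frac{2\pi i}{n},\,1)^{\mathrm T}$, $i=1,\dots,n$. The unit effect is $u=(0,0,1)^{\mathrm T}$; the probability of an effect $e$ on a state $\omega$ is $e^{\mathrm T}\omega$, and the effects are all $e\in\mathbb R^3$ with $0\le e^{\mathrm T}\omega\le 1$ for all $\omega\in\Omega_n$. For even $n$ the extremal effects other than $0$ and $u$ are $e_i=\frac12(r_n\cos\frac{(2i-1)\pi}{n},\,r_n\sin\frac{(2i-1)\pi}{n},\,1)^{\mathrm T}$, $i=1,\dots,n$; the complementary effect $\bar e_i=u-e_i$ equals $e_{i+n/2}$ (indices mod $n$). Bipartite (maximal tensor product) states are the real $3\times3$ matrices $\Phi$ with $u^{\mathrm T}\Phi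 u=1$ and $e^{\mathrm T}\Phi f\ge 0$ for all effects $e,f$. The joint probability of Alice's effect $E$ and Bob's effect $F$ on $\Phi$ is $P(E,F)=E^{\mathrm T}\Phi F$. Measurements used in Hardy's test: Alice has $\mathcal M_1=\{E_1^{A+},E_1^{A-}\}$ with effects $\{e_i,\bar e_i\}$ and $\mathcal M_2=\{E_2^{A+},E_2^{A-}\}$ with effects $\{e_j,\bar e_j\}$, $\mathcal M_1$ and $\mathcal M_2$ being different as unordered pairs of effects; Bob has $\mathcal N_1=\{E_1^{B+},E_1^{B-}\}$ with effects $\{e_k,\bar e_k\}$ and $\mathcal N_2=\{E_2^{B+},E_2^{B-}\}$ with effects $\{e_l,\bar e_l\}$, again different. In each measurement either effect may be assigned the label $+$ (the other gets the label $-$). *)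

(* Defs.v *)
From mathcomp Require Import all_boot all_order all_algebra.
From mathcomp Require Import boolp classical_sets reals trigo.

Set Implicit Arguments.
Unset Strict Implicit.
Unset Printing Implicit Defensive.
Import Order.TTheory GRing.Theory Num.Theory.
Local Open Scope classical_set_scope.
Local Open Scope ring_scope.

Definition col3 (R : realType) (a b c : R) : 'cV[R]_3 :=
  \col_(k < 3) [:: a; b; c]`_k.

(* r_n = sqrt (sec (pi / n)) *)
Definition polygon_radius (R : realType) (n : nat) : R :=
  Num.sqrt (cos (pi / n%:R))^-1.

Definition pure_state (R : realType) (n i : nat) : 'cV[R]_3 :=
  col3 (polygon_radius R n * cos (2 * pi * i%:R / n%:R))
       (polygon_radius R n * sin (2 * pi * i%:R / n%:R))
       1.

(* Convex hull of the pure states with indices 1, ..., n. *)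
Definition state_space (R : realType) (n : nat) : set 'cV[R]_3 :=
  [set w | exists a : nat -> R,
    [/\ forall i, 0 <= a i,
        \sum_(1 <= i < n.+1) a i = 1 &
        w = \sum_(1 <= i < n.+1) a i *: pure_state R n i]].

Definition unit_effect (R : realType) : 'cV[R]_3 := col3 0 0 1.

Definition prob (R : realType) (e w : 'cV[R]_3) : R := (e^T *m w) 0 0.

Definition effect (R : realType) (n : nat) : set 'cV[R]_3 :=
  [set e | forall w, state_space n w -> 0 <= prob e w <= 1].

Definition ext_effect (R : realType) (n i : nat) : 'cV[R]_3 :=
  2^-1 *: col3 (polygon_radius R n * cos ((2 * i%:R - 1) * pi / n%:R))
               (polygon_radius R n * sin ((2 * i%:R - 1) * pi / n%:R))
               1.

Definition compl_effect (R : realType) (e : 'cV[R]_3) : 'cV[R]_3 :=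
  unit_effect R - e.

Definition joint_prob (R : realType) (Phi : 'M[R]_3) (E F : 'cV[R]_3) : R :=
  (E^T *m Phi *m F) 0 0.

(* Maximal tensor product: positivity is required on product effects only. *)
Definition bipartite_state (R : realType) (n : nat) : set 'M[R]_3 :=
  [set Phi | joint_prob Phi (unit_effect R) (unit_effect R) = 1 /\
    forall e f, effect n e -> effect n f -> 0 <= joint_prob Phi e f].

Record measurement (R : realType) := Measurement {
  plus_effect : 'cV[R]_3;
  minus_effect : 'cV[R]_3
}.

Definition polygon_measurement (R : realType) (n : nat) :
    set (measurement R) :=
  [set M | exists i : nat, (1 <= i <= n)%N /\
    (M = Measurement (ext_effect R n i) (compl_effect (ext_effect R n i)) \/
     M = Measurement (compl_effect (ext_effect R n i)) (ext_effect R n i))].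

(* The unordered pair of effects, forgetting the labels. *)
Definition effect_pair (R : realType) (M : measurement R) : set 'cV[R]_3 :=
  [set plus_effect M; minus_effect M].

Definition hardy_conditions (R : realType) (Phi : 'M[R]_3)
    (M1 M2 N1 N2 : measurement R) : Prop :=
  [/\ joint_prob Phi (plus_effect M1) (plus_effect N2) = 0,
      joint_prob Phi (plus_effect M2) (plus_effect N1) = 0 &
      joint_prob Phi (minus_effect M2) (minus_effect N2) = 0].

(* M1, M2 are Alice's measurements and N1, N2 are Bob's. *)
Definition hardy_success_probs (R : realType) (n : nat) (Phi : 'M[R]_3) :
    set R :=
  [set p | exists M1 M2 N1 N2 : measurement R,
    [/\ polygon_measurement n M1 /\ polygon_measurement n M2,
        polygon_measurement n N1 /\ polygon_measurement n N2,
        effect_pair M1 <> effect_pair M2 /\ effect_pair N1 <> effect_pair N2,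
        hardy_conditions Phi M1 M2 N1 N2 &
        p = joint_prob Phi (plus_effect M1) (plus_effect N1)]].

Definition is_maximum (R : realType) (S : set R) (m : R) : Prop :=
  S m /\ ubound S m.

Definition Phi_J (R : realType) (n : nat) : 'M[R]_3 :=
  \matrix_(p < 3, q < 3)
    (nth [::] [:: [:: cos (pi / n%:R); sin (pi / n%:R); 0];
                  [:: - sin (pi / n%:R); cos (pi / n%:R); 0];
                  [:: 0; 0; 1]] p)`_q.

(* Main.v *)
(** With [theta = pi / n], the extremal effects are halves of the vectors
    [ray t] for [t] an odd multiple of [theta], complementation is
    [t |-> t + pi], and on [Phi_J] the effects of angles [s] and [t] have
    probability [(1 + cos (s - t + theta) / cos theta) / 4]. A Hardy condition
    thus says that an angle is [pi +- theta] modulo [2 pi]. The angle of the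
    success probability is the alternating sum of the angles of the three
    conditions, hence [pi +- theta] or [pi +- 3 theta], which gives the
    probabilities [0] and [sin theta ^+ 2]. *)
Require Import Defs.
From mathcomp Require Import all_boot all_order all_algebra.
From mathcomp Require Import boolp classical_sets reals trigo.
From mathcomp Require Import ring lra zify.
Local Open Scope ring_scope.
Import Order.TTheory GRing.Theory Num.Theory.

(** * Coordinate formulas in dimension three *)

Lemma sum_ord3 (V : nmodType) (F : 'I_3 -> V) :
  \sum_(i < 3) F i = F 0 + F 1 + F ord_max.
Proof.
rewrite !big_ord_recl big_ord0 addr0 addrA.
by congr (F _ + F _ + F _); apply: val_inj.
Qed.

Lemma col3_eta (R : realType) (e : 'cV[R]_3) :
  e = col3 (e 0 0) (e 1 0) (e ord_max 0).
Proof.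
apply/matrixP=> i j; rewrite mxE ord1.
by case: i => [[|[|[|//]]] hi]; congr (e _ _); apply: val_inj.
Qed.

Lemma prob_col3 (R : realType) (a b c a' b' c' : R) :
  prob (col3 a b c) (col3 a' b' c') = a * a' + b * b' + c * c'.
Proof. by rewrite /prob !mxE sum_ord3 !mxE. Qed.

Lemma joint_prob_Phi_J (R : realType) (n : nat) (a b c a' b' c' : R) :
  joint_prob (Phi_J R n) (col3 a b c) (col3 a' b' c') =
  a * (cos (pi / n%:R) * a' + sin (pi / n%:R) * b') +
  b * (- sin (pi / n%:R) * a' + cos (pi / n%:R) * b') + c * c'.
Proof. by rewrite /joint_prob !mxE sum_ord3 !mxE !sum_ord3 !mxE /=; ring. Qed.

(** One circle carries both families: pure states sit at even multiples of [pi / n], doubled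
    extremal effects at odd ones. *)
Definition ray (R : realType) (n : nat) (t : R) : 'cV[R]_3 :=
  col3 (polygon_radius R n * cos t) (polygon_radius R n * sin t) 1.

Lemma scale_col3 (R : realType) (k a b c : R) :
  k *: col3 a b c = col3 (k * a) (k * b) (k * c).
Proof. by apply/matrixP=> i j; rewrite !mxE; case: i => [[|[|[|]]]]. Qed.

Lemma compl_ray (R : realType) (n : nat) (t : R) :
  compl_effect (2^-1 *: ray R n t) = 2^-1 *: ray R n (t + pi).
Proof.
apply/matrixP=> i j; rewrite !mxE cosDpi sinDpi.
by case: i => [[|[|[|//]]] hi] /=; lra.
Qed.

Section Polygon.
Context (R : realType) (n m : nat) (n_gt3 : (3 < n)%N) (n_double : n = m.*2).

Local Notation theta := (pi / n%:R : R).
Local Notation r := (polygon_radius R n).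

(** * The angle [theta] and the radius of the polygon *)

Lemma angle_double : m%:R * theta *+ 2 = pi.
Proof.
have m0 : m%:R != 0 :> R by rewrite pnatr_eq0; lia.
by rewrite n_double -muln2 natrM -mulr_natr; field; rewrite m0.
Qed.

Lemma angle_bounds : 0 < theta <= pi / 4.
Proof.
have h4 : (4 : R) <= n%:R by rewrite (ler_nat R 4 n).
have pi0 := pi_gt0 R; apply/andP; split; first by rewrite divr_gt0; lra.
by rewrite ler_pM2l // lef_pV2 ?posrE; lra.
Qed.

Lemma cos_angle_gt0 : 0 < cos theta.
Proof.
have /andP[t0 t1] := angle_bounds; have pi0 := pi_gt0 R.
by apply: cos_gt0_pihalf; apply/andP; split; lra.
Qed.

Lemma sin_angle_gt0 : 0 < sin theta.
Proof.
have /andP[t0 t1] := angle_bounds; have pi0 := pi_gt0 R.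
by apply: sin_gt0_pi; apply/andP; split; lra.
Qed.

Lemma cos_double_angle_bounds : 0 <= cos (theta *+ 2) < 1.
Proof.
have /andP[t0 t1] := angle_bounds; have pi0 := pi_gt0 R.
apply/andP; split; first by apply: cos_ge0_pihalf; apply/andP; split; lra.
have := cos2Dsin2 theta; have := sin_angle_gt0.
by rewrite cos_mulr2n; nra.
Qed.

Lemma radius_sqr : r ^+ 2 * cos theta = 1.
Proof.
have c0 := cos_angle_gt0.
rewrite /polygon_radius sqr_sqrtr ?invr_ge0 ?ltW //.
by rewrite mulVf // gt_eqF.
Qed.

Lemma radius_gt0 : 0 < r.
Proof. by rewrite sqrtr_gt0 invr_gt0 cos_angle_gt0. Qed.

(** * Extremal effects, complements and labels *)

Lemma ext_effect_ray (i : nat) :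
  ext_effect R n i = 2^-1 *: ray R n ((2 * i%:R - 1) * theta).
Proof. by rewrite /ext_effect /ray !mulrA. Qed.

Lemma compl_ext_effect (i : nat) :
  compl_effect (ext_effect R n i) = ext_effect R n (i + m).
Proof.
rewrite !ext_effect_ray compl_ray; congr (_ *: ray _ _ _).
by rewrite -[X in _ + X]angle_double natrD; ring.
Qed.

Lemma compl_effectK (e : 'cV[R]_3) : compl_effect (compl_effect e) = e.
Proof. by rewrite /compl_effect subKr. Qed.

(** Swapping the labels shifts the index by [m], so a single labelling remains to be treated. The
    shifted index may exceed [n]; only its angle matters. *)
Lemma polygon_measurementP (M : measurement R) : polygon_measurement n M ->
  exists i, plus_effect M = ext_effect R n i /\
            minus_effect M = compl_effect (ext_effect R n i).
Proof.
case=> i [_ [->|->]]; first by exists i.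
by exists (i + m)%N; rewrite -compl_ext_effect compl_effectK.
Qed.

(** * Joint probabilities on [Phi_J] and the Hardy conditions *)

Lemma joint_prob_ray (s t : R) :
  joint_prob (Phi_J R n) (2^-1 *: ray R n s) (2^-1 *: ray R n t) =
  (1 + cos (s - t + theta) / cos theta) / 4.
Proof.
rewrite /ray !scale_col3 joint_prob_Phi_J.
have c0 : cos theta != 0 by rewrite gt_eqF ?cos_angle_gt0.
have -> : (cos theta)^-1 = r ^+ 2 by rewrite -[RHS](mulfK c0) radius_sqr mul1r.
by rewrite cosD cosB sinB; field.
Qed.

Lemma joint_prob_ray_eq0 (s t : R) :
  joint_prob (Phi_J R n) (2^-1 *: ray R n s) (2^-1 *: ray R n t) = 0 ->
  cos (s - t + theta) = - cos theta.
Proof.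
have c0 : cos theta != 0 by rewrite gt_eqF ?cos_angle_gt0.
rewrite joint_prob_ray => h.
have {}h : 1 + cos (s - t + theta) / cos theta = 0 by lra.
by rewrite -[LHS](divfK c0); nra.
Qed.

(** Complementing both effects adds [pi] to both angles and keeps their difference. *)
Lemma joint_prob_compl_ray_eq0 (s t : R) :
  joint_prob (Phi_J R n) (compl_effect (2^-1 *: ray R n s))
    (compl_effect (2^-1 *: ray R n t)) = 0 ->
  cos (s - t + theta) = - cos theta.
Proof.
rewrite !compl_ray => /joint_prob_ray_eq0 <-.
by congr cos; ring.
Qed.

Lemma cos_opp_sin (c s x : R) : c ^+ 2 + s ^+ 2 = 1 -> cos x = - c ->
  sin x = s \/ sin x = - s.
Proof.
move=> cs hx; apply/pred2P; rewrite -eqf_sqr; apply/eqP.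
have := cos2Dsin2 x; rewrite hx; nra.
Qed.

(* If [A], [B], [C] all lie in [pi +- theta] modulo [2 pi], then [A - C + B]
   is [pi +- theta] or [pi +- 3 theta]; [3 c - 4 c ^ 3 = - cos (3 theta)]. *)
Lemma cos_hardy_combination (A B C : R) :
  cos A = - cos theta -> cos B = - cos theta -> cos C = - cos theta ->
  cos (A - C + B) <= 3 * cos theta - 4 * cos theta ^+ 3.
Proof.
have cs := cos2Dsin2 theta; have c0 := cos_angle_gt0.
have s2 : sin theta ^+ 2 = 1 - cos theta ^+ 2 by lra.
have c1 : cos theta ^+ 3 <= cos theta.
  have := sqr_ge0 (sin theta); rewrite s2 => hs; rewrite exprS; nra.
have s2c : cos theta * sin theta ^+ 2 = cos theta - cos theta ^+ 3.
  by rewrite s2; ring.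
move=> hA hB hC; rewrite cosD cosB sinB hA hB hC.
(* Writing [c] for [cos theta], the value is [3 * c - 4 * c ^+ 3] when [A] and [B] have the same
   sine and [C] the opposite one, and [- c] in the six other cases; [c1] compares the two values. *)
have [-> |->] := cos_opp_sin _ _ A cs hA;
have [-> |->] := cos_opp_sin _ _ B cs hB;
have [-> |->] := cos_opp_sin _ _ C cs hC;
lra.
Qed.

(** * Distinctness of adjacent measurements *)

Lemma cos_ray_eq (s t : R) : ray R n s = ray R n t -> cos (t - s) = 1.
Proof.
have r0 : r != 0 by rewrite gt_eqF ?radius_gt0.
move=> /matrixP h.
have := h 0 0; rewrite !mxE /= => /(mulfI r0) hc.
have := h 1 0; rewrite !mxE /= => /(mulfI r0) hs.
by rewrite cosB hc hs -!expr2 cos2Dsin2.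
Qed.

(** The angles of [e i.+1] and of its complement exceed that of [e i] by [2 theta] and
    [2 theta + pi], whose cosines are both below 1. *)
Lemma effect_pair_adjacent (i : nat) :
  let e := ext_effect R n in
  effect_pair (Measurement (e i) (compl_effect (e i))) <>
  effect_pair (Measurement (e i.+1) (compl_effect (e i.+1))).
Proof.
move=> e; have /andP[c0 c1] := cos_double_angle_bounds => h.
have : effect_pair (Measurement (e i) (compl_effect (e i))) (e i) by left.
have half0 : 2^-1 != 0 :> R by lra.
rewrite h /e !ext_effect_ray compl_ray => -[] /(scalerI half0) /cos_ray_eq.
  suff -> : (2 * i.+1%:R - 1) * theta - (2 * i%:R - 1) * theta = theta *+ 2
    by lra.
  by rewrite -natr1; ring.
suff -> : (2 * i.+1%:R - 1) * theta + pi - (2 * i%:R - 1) * theta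
  = theta *+ 2 + pi by rewrite cosDpi; lra.
by rewrite -natr1; ring.
Qed.

(** * Pure states and positivity of [Phi_J] *)

Lemma pure_state_ray (i : nat) : pure_state R n i = ray R n (2 * i%:R * theta).
Proof.
rewrite /pure_state /ray.
by have -> : 2 * pi * i%:R / n%:R = 2 * i%:R * theta by ring.
Qed.

Lemma state_space_pure (i : nat) : (0 < i <= n)%N ->
  state_space n (pure_state R n i).
Proof.
move=> hi; exists (fun j => (j == i)%:R).
have hmem : i \in index_iota 1 n.+1 by rewrite mem_index_iota.
split=> [j||]; first exact: ler0n.
- rewrite (bigD1_seq i) ?iota_uniq //= eqxx big1 ?addr0 // => j /negPf -> //.
- rewrite (bigD1_seq i) ?iota_uniq //= eqxx scale1r big1 ?addr0 //.
  by move=> j /negPf ->; rewrite scale0r.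
Qed.

Lemma pure_state_period (i q : nat) :
  pure_state R n (i + q * n) = pure_state R n i.
Proof.
have n0 : n%:R != 0 :> R by rewrite pnatr_eq0; lia.
rewrite !pure_state_ray; elim: q => [|q IH]; first by rewrite mul0n addn0.
rewrite -{}IH /ray.
have -> : 2 * (i + q.+1 * n)%:R * theta = 2 * (i + q * n)%:R * theta + pi *+ 2.
  by rewrite mulSn !natrD; field.
by rewrite cosD2pi sinD2pi.
Qed.

(** States are numbered from 1, so the reduction modulo [n] acts on the predecessor. *)
Lemma pure_state_modn (i : nat) : (0 < i)%N ->
  pure_state R n i = pure_state R n (i.-1 %% n).+1.
Proof.
move=> i0; rewrite -[RHS](pure_state_period _ (i.-1 %/ n)); congr pure_state.
by rewrite addSn addnC -divn_eq prednK.
Qed.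

Lemma prob_pure_state_ge0 (e : 'cV[R]_3) (i : nat) : effect n e -> (0 < i)%N ->
  0 <= prob e (pure_state R n i).
Proof.
move=> he i0; rewrite pure_state_modn //.
have hi : (0 < (i.-1 %% n).+1 <= n)%N by rewrite /= ltn_mod; lia.
by have /andP[] := he _ (state_space_pure _ hi).
Qed.

(** Periodicity reduces this to a finite maximum; letting [j] be any positive index gives the
    neighbours of [k] without wraparound. *)
Lemma prob_pure_state_max (e : 'cV[R]_3) : exists2 k, (0 < k)%N &
  forall j, (0 < j)%N -> prob e (pure_state R n j) <= prob e (pure_state R n k).
Proof.
have n0 : (0 < n)%N by lia.
pose g (k : 'I_n) := prob e (pure_state R n k.+1).
have [k _ kmax] := @arg_maxP _ _ _ (Ordinal n0) xpredT g isT.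
exists k.+1 => // j j0; rewrite (pure_state_modn _ j0).
have lt_mod : (j.-1 %% n < n)%N by rewrite ltn_mod.
exact: (kmax (Ordinal lt_mod) isT).
Qed.

(* The spatial part of [f] lies in the sector between the directions of two
   adjacent extremal effects, around the pure state [k] on which [f] is most
   likely: [f] is then a nonnegative combination of these two effects and [u].
   [Phi_J] maps the two effects to multiples of pure states. *)
Lemma Phi_J_ge0 (e f : 'cV[R]_3) : effect n e -> effect n f ->
  0 <= joint_prob (Phi_J R n) e f.
Proof.
move=> he hf; have [k k0 kmax] := prob_pure_state_max f.
have n0 : n%:R != 0 :> R by rewrite pnatr_eq0; lia.
have r0 := radius_gt0; have c0 := cos_angle_gt0; have s0 := sin_angle_gt0.
have r2c := radius_sqr.
set t := 2 * k%:R * theta.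
have stk : pure_state R n k = ray R n t by rewrite pure_state_ray.
have st_next : pure_state R n k.+1 = ray R n (t + theta *+ 2).
  by rewrite pure_state_ray; congr ray; rewrite /t -natr1; ring.
(* The neighbour before [k] is indexed by [k + n.-1] to keep the index positive. *)
have st_prev : pure_state R n (k + n.-1) = ray R n (t - theta *+ 2).
  rewrite pure_state_ray.
  have -> : 2 * (k + n.-1)%:R * theta = t - theta *+ 2 + pi *+ 2.
    by rewrite /t natrD -subn1 natrB; [field|lia].
  by rewrite /ray cosD2pi sinD2pi.
have st_opp : pure_state R n (k + m) = ray R n (t + pi).
  rewrite pure_state_ray; congr ray.
  by rewrite natrD -[X in _ = _ + X]angle_double /t; ring.
have hk1 : (0 < k + n.-1)%N by lia.
have hkm : (0 < k + m)%N by lia.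
have h0 := prob_pure_state_ge0 _ _ he k0.
have h1 := prob_pure_state_ge0 _ _ he hk1.
have h2 := prob_pure_state_ge0 _ _ he hkm.
have f2 := prob_pure_state_ge0 _ _ hf hkm.
have m1 := kmax _ hk1; have m2 := kmax k.+1 isT.
move: h0 h1 h2 f2 m1 m2; rewrite stk st_next st_prev st_opp.
rewrite (col3_eta _ e) (col3_eta _ f) /ray !prob_col3 joint_prob_Phi_J.
set x := e 0 0; set y := e 1 0; set z := e ord_max 0.
set x' := f 0 0; set y' := f 1 0; set z' := f ord_max 0.
rewrite !cosDpi !sinDpi !(cosB t) !(sinB t) !(cosD t) !(sinD t).
rewrite !cos_mulr2n !sin_mulr2n.
have CS := cos2Dsin2 t; have cs := cos2Dsin2 theta.
move: (cos t) (sin t) (cos theta) (sin theta) r CS cs r0 c0 s0 r2c.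
move=> C S c s ro CS cs r0 c0 s0 r2c h0 h1 h2 f2 m1 m2.
(* Coordinates of the spatial part of [f] along and across the direction of the pure state [k]. *)
pose X := x' * C + y' * S; pose Y := y' * C - x' * S.
have C2 : C ^+ 2 = 1 - S ^+ 2 by lra.
have c2 : c ^+ 2 = 1 - s ^+ 2 by lra.
have hx : x' = X * C - Y * S by rewrite /X /Y; ring: C2.
have hy : y' = X * S + Y * C by rewrite /X /Y; ring: C2.
(* The probabilities of [e] on the opposite states [k] and [k + m] add up to [2 z]. *)
have z0 : 0 <= z by lra.
clearbody x y z x' y' z' X Y; subst x' y'.
have scale0 : 0 < ro * s *+ 2 by rewrite pmulrn_lgt0 ?mulr_gt0.
(* Up to positive factors, [b0], [a0] and [zX] bound the coefficients of [f] on the effects at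
   angles [t + theta] and [t - theta] and on [u]. The first two use the maximality of [k] against
   its neighbours, the third the state opposite to [k]. *)
have b0 : 0 <= X * s + Y * c.
  rewrite -(pmulr_rge0 _ scale0).
  move: m1; rewrite -subr_ge0; congr (0 <= _); ring: C2 c2.
have a0 : 0 <= X * s - Y * c.
  rewrite -(pmulr_rge0 _ scale0).
  move: m2; rewrite -subr_ge0; congr (0 <= _); ring: C2 c2.
have zX : 0 <= c * ro * z' - X.
  have := mulr_ge0 (ltW (mulr_gt0 c0 r0)) f2; congr (0 <= _).
  by ring: C2 r2c.
(* The factor clears the denominators of the coefficients. [Phi_J] rotates by [- theta], so the
   effect at [t - theta] is paired with [h1], the one at [t + theta] with [h0], and [u] with [z]. *)
rewrite -(pmulr_rge0 _ (mulr_gt0 c0 scale0)).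
have := addr_ge0 (addr_ge0 (mulr_ge0 a0 h1) (mulr_ge0 b0 h0))
  (mulrn_wge0 2 (mulr_ge0 (mulr_ge0 (ltW s0) z0) zX)).
congr (0 <= _).
by ring: C2 c2.
Qed.

Lemma Phi_J_bipartite_state : bipartite_state n (Phi_J R n).
Proof.
split; last exact: Phi_J_ge0.
by rewrite /unit_effect joint_prob_Phi_J; ring.
Qed.

(** * The maximal success probability *)

Lemma hardy_success_max :
  is_maximum (hardy_success_probs n (Phi_J R n)) (sin theta ^+ 2).
Proof.
have c0 := cos_angle_gt0; have cs := cos2Dsin2 theta.
have cn0 : cos theta != 0 by rewrite gt_eqF.
have joint0 s t : cos (s - t + theta) = - cos theta ->
    joint_prob (Phi_J R n) (2^-1 *: ray R n s) (2^-1 *: ray R n t) = 0.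
  by move=> h; rewrite joint_prob_ray h mulNr divff // subrr mul0r.
have two_m : m%:R * 2 * theta = pi by rewrite -[RHS]angle_double; ring.
split.
- pose M i := Measurement (ext_effect R n i) (compl_effect (ext_effect R n i)).
  have M_polygon i : (0 < i <= n)%N -> polygon_measurement n (M i).
    by move=> hi; exists i; split=> //; left.
  (* These indices give the three conditions the angles [pi - theta], [pi - theta] and [pi + theta],
     hence the angle [pi - 3 theta] for the success probability. *)
  exists (M m), (M m.+1), (M 2%N), (M 1%N); split.
  + by split; apply: M_polygon; lia.
  + by split; apply: M_polygon; lia.
  + split; first exact: effect_pair_adjacent.
    by apply: nesym; exact: effect_pair_adjacent.
  + rewrite /hardy_conditions /= !ext_effect_ray !compl_ray.
    split; apply: joint0.
    * transitivity (cos (- theta + pi)); last by rewrite cosDpi cosN.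
      by congr cos; lra.
    * transitivity (cos (- theta + pi)); last by rewrite cosDpi cosN.
      by congr cos; rewrite -natr1; lra.
    * rewrite -cosDpi; congr cos; rewrite -natr1; lra.
  + rewrite /= !ext_effect_ray joint_prob_ray.
    have -> : (2 * m%:R - 1) * theta - (2 * 2 - 1) * theta + theta
      = - (theta *+ 2 + theta) + pi by lra.
    rewrite cosDpi cosN cosD cos_mulr2n sin_mulr2n sin2cos2.
    have s2 : sin theta ^+ 2 = 1 - cos theta ^+ 2 by lra.
    by field: s2; rewrite cn0.
- move=> p [M1 [M2 [N1 [N2 [[hM1 hM2] [hN1 hN2] _ [z12 z21 z22] ->]]]]].
  have [i [eM1 _]] := polygon_measurementP _ hM1.
  have [j [eM2 fM2]] := polygon_measurementP _ hM2.
  have [k [eN1 _]] := polygon_measurementP _ hN1.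
  have [l [eN2 fN2]] := polygon_measurementP _ hN2.
  move: z12 z21 z22; rewrite eM1 eM2 fM2 eN1 eN2 fN2 !ext_effect_ray.
  move=> /joint_prob_ray_eq0 hA /joint_prob_ray_eq0 hB.
  move=> /joint_prob_compl_ray_eq0 hC.
  have := cos_hardy_combination _ _ _ hA hB hC.
  rewrite joint_prob_ray; set D := _ - _ + _; set D' := _ - _ + theta.
  have -> : D = D' by rewrite /D /D'; ring.
  move=> hD; have {}hD : cos D' / cos theta <= 3 - 4 * cos theta ^+ 2.
    by rewrite ler_pdivrMr //; lra.
  by rewrite sin2cos2; lra.
Qed.

End Polygon.

Theorem theorem2 (R : realType) (n : nat) (hn : (4 <= n)%N)
    (n_even : ~~ odd n) :
  [/\ bipartite_state n (Phi_J R n),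
      is_maximum (hardy_success_probs n (Phi_J R n)) (sin (pi / n%:R) ^+ 2) &
      0 < sin (pi / n%:R) ^+ 2 :> R].
Proof.
have n_double : n = n./2.*2 by rewrite even_halfK.
split; last by rewrite exprn_gt0 // sin_angle_gt0.
- exact: Phi_J_bipartite_state n_double.
- exact: hardy_success_max n_double.
Qed.
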